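(* Let $K\to R$ be a homomorphism of commutative rings, and let $U$ and $V$ be two $R$-modules. Let $R\to S$ be a flat epimorphism of commutative rings and $D_R\colon U\to V$ be a $K$-linear $R$-differential operator. Then there exists a unique $K$-linear $S$-differential operator $D_S\colon S\otimes_RU\to S\otimes_RV$ for which the square diagram formed by $D_R$, $D_S$ and the natural maps $U\to S\otimes_RU$, $u\mapsto 1\otimes u$, and $V\to S\otimes_RV$, $v\mapsto 1\otimes v$, is commutative, i.e., $D_S(1\otimes u)=1\otimes D_R(u)$ for all $u\in U$.
   Context: For a homomorphism of commutative rings $K\to R$ and $R$-modules $U$, $V$, the group $E=\mathrm{Hom}_K(U,V)$ is an $R$-$R$-bimodule: $(re)(u)=r\,e(u)$, $(er)(u)=e(ru)$. For $r\in R$ put $\theta_r(e)=re-er$. A $K$-linear map $e\colon U\to V$ is called a $K$-linear $R$-differential operator if for every $r\in R$ there exists an integer $n\ge0$ (depending on $r$) such that $(\theta_r)^{n+1}(e)=0$. The same definition with $S$ in place of $R$ (using the composition $K\to R\to S$) gives $K$-linear $S$-differential operators between $S$-modules. A flat epimorphism of commutative rings $R\to S$ is an epimorphism in the category of commutative rings such that $S$ is a flat $R$-module. *)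

(* Defs.v *)
From HB Require Import structures.
From mathcomp Require Import all_boot all_algebra.
From mathcomp Require Import boolp.

Set Implicit Arguments.
Unset Strict Implicit.
Unset Printing Implicit Defensive.

Import GRing.Theory.
Local Open Scope ring_scope.
Local Open Scope quotient_scope.

(* Rings are [comPzRingType]s, so the zero ring is allowed. *)

(* [restrict phi W] is the S-module W viewed as an R-module along phi. *)
Definition restrict (R S : comPzRingType) (phi : {rmorphism R -> S})
  (W : lmodType S) : Type := W.

Section Restrict.
Variables (R S : comPzRingType) (phi : {rmorphism R -> S}) (W : lmodType S).

HB.instance Definition _ := GRing.Zmodule.on (restrict phi W).

Definition restrict_scale (r : R) (w : restrict phi W) : restrict phi W :=
  phi r *: (w : W).

Fact restrict_scalerA a b w :
  restrict_scale a (restrict_scale b w) = restrict_scale (a * b) w.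
Proof. by rewrite /restrict_scale scalerA rmorphM. Qed.

Fact restrict_scale1r : left_id 1 restrict_scale.
Proof. by move=> w; rewrite /restrict_scale rmorph1 scale1r. Qed.

Fact restrict_scalerDr : right_distributive restrict_scale +%R.
Proof. by move=> a v w; rewrite /restrict_scale scalerDr. Qed.

Fact restrict_scalerDl w : {morph restrict_scale^~ w : a b / a + b}.
Proof. by move=> a b; rewrite /restrict_scale rmorphD scalerDl. Qed.

HB.instance Definition _ := GRing.Zmodule_isLmodule.Build R (restrict phi W)
  restrict_scalerA restrict_scale1r restrict_scalerDr restrict_scalerDl.

End Restrict.

(* The tensor product of M and N over R: finite sequences of pairs (m, n),
   read as the sums of the m (x) n, modulo the congruence generated by the
   bilinearity relations.  Opposites exist in the quotient because -m (x) n
   is an opposite of m (x) n. *)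
Inductive tensor_eq (R : comPzRingType) (M N : lmodType R) :
    seq (M * N) -> seq (M * N) -> Prop :=
| tensor_eq_refl s : tensor_eq s s
| tensor_eq_sym s t : tensor_eq s t -> tensor_eq t s
| tensor_eq_trans s t u : tensor_eq s t -> tensor_eq t u -> tensor_eq s u
| tensor_eq_cat s s' t t' :
    tensor_eq s s' -> tensor_eq t t' -> tensor_eq (s ++ t) (s' ++ t')
| tensor_eq_catC s t : tensor_eq (s ++ t) (t ++ s)
| tensor_eq_0l n : tensor_eq [:: (0, n)] [::]
| tensor_eq_Dl m m' n : tensor_eq [:: (m + m', n)] [:: (m, n); (m', n)]
| tensor_eq_Dr m n n' : tensor_eq [:: (m, n + n')] [:: (m, n); (m, n')]
| tensor_eq_Z r m n : tensor_eq [:: (r *: m, n)] [:: (m, r *: n)].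

Section Tensor.
Variables (R : comPzRingType) (M N : lmodType R).

Definition tensor_eqb : rel (seq (M * N)) := fun s t => `[< tensor_eq s t >].

Fact tensor_eqb_refl : reflexive tensor_eqb.
Proof. by move=> s; apply/asboolP; exact: tensor_eq_refl. Qed.

Fact tensor_eqb_sym : symmetric tensor_eqb.
Proof. by move=> s t; apply/asboolP/asboolP; exact: tensor_eq_sym. Qed.

Fact tensor_eqb_trans : transitive tensor_eqb.
Proof.
move=> t s u /asboolP st /asboolP tu; apply/asboolP.
exact: tensor_eq_trans st tu.
Qed.

Canonical tensor_equiv :=
  EquivRel tensor_eqb tensor_eqb_refl tensor_eqb_sym tensor_eqb_trans.

Definition tensor : Type := {eq_quot tensor_equiv}.

HB.instance Definition _ := Choice.on tensor.

Definition tclass (s : seq (M * N)) : tensor := \pi_{eq_quot tensor_equiv} s.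

Definition trepr (x : tensor) : seq (M * N) :=
  repr (x : {eq_quot tensor_equiv}).

Definition tprod (m : M) (n : N) : tensor := tclass [:: (m, n)].

Lemma treprK : cancel trepr tclass.
Proof. by move=> x; exact: reprK. Qed.

Lemma tclassP s t : tclass s = tclass t <-> tensor_eq s t.
Proof.
split=> [/eqP|st]; first by rewrite /tclass eqmodE => /asboolP.
by apply/eqP; rewrite /tclass eqmodE; apply/asboolP.
Qed.

Lemma tclassK s : tensor_eq (trepr (tclass s)) s.
Proof. by apply/tclassP; rewrite treprK. Qed.

Definition tadd (x y : tensor) : tensor := tclass (trepr x ++ trepr y).

Definition topp (x : tensor) : tensor :=
  tclass [seq (- p.1, p.2) | p <- trepr x].

Definition tscale (r : R) (x : tensor) : tensor :=
  tclass [seq (r *: p.1, p.2) | p <- trepr x].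

Lemma tadd_class s t : tadd (tclass s) (tclass t) = tclass (s ++ t).
Proof. by apply/tclassP; apply: tensor_eq_cat; exact: tclassK. Qed.

Fact taddA : associative tadd.
Proof.
move=> x y z; rewrite -(treprK x) -(treprK y) -(treprK z).
by rewrite !tadd_class catA.
Qed.

Fact taddC : commutative tadd.
Proof. by move=> x y; apply/tclassP; exact: tensor_eq_catC. Qed.

Fact tadd0 : left_id (tclass [::]) tadd.
Proof. by move=> x; rewrite -(treprK x) tadd_class. Qed.

Fact taddN : left_inverse (tclass [::]) topp tadd.
Proof.
move=> x; rewrite /topp -{2}(treprK x) tadd_class; apply/tclassP.
elim: (trepr x) => [|[m n] s IHs] /=; first exact: tensor_eq_refl.
set s' := map _ _ in IHs *.
apply: (@tensor_eq_trans _ _ _ _ ([:: (- m, n); (m, n)] ++ (s' ++ s))).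
  rewrite -cat1s -(cat1s (m, n) s) -(cat1s (- m, n) [:: (m, n)]) -catA.
  apply: tensor_eq_cat; first exact: tensor_eq_refl.
  rewrite !catA; apply: tensor_eq_cat; last exact: tensor_eq_refl.
  exact: tensor_eq_catC.
rewrite -[[::]]/([::] ++ [::]); apply: tensor_eq_cat => //.
apply: tensor_eq_trans (tensor_eq_0l _ n); rewrite -(addNr m).
exact/tensor_eq_sym/tensor_eq_Dl.
Qed.

HB.instance Definition _ :=
  GRing.isZmodule.Build tensor taddA taddC tadd0 taddN.

Lemma tclassD s t : tclass (s ++ t) = tclass s + tclass t.
Proof. by rewrite -tadd_class. Qed.

Lemma tclass_sum s : tclass s = \sum_(p <- s) tprod p.1 p.2.
Proof.
elim: s => [|[m n] s IHs]; first by rewrite big_nil.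
by rewrite big_cons -cat1s tclassD IHs.
Qed.

Lemma tprodDl m m' n : tprod (m + m') n = tprod m n + tprod m' n.
Proof. by rewrite -tclassD; apply/tclassP/tensor_eq_Dl. Qed.

Lemma tprodDr m n n' : tprod m (n + n') = tprod m n + tprod m n'.
Proof. by rewrite -tclassD; apply/tclassP/tensor_eq_Dr. Qed.

Lemma tprodZ r m n : tprod (r *: m) n = tprod m (r *: n).
Proof. by apply/tclassP/tensor_eq_Z. Qed.

Section Lift.
Variables (G : zmodType) (b : M -> N -> G).
Hypothesis bDl : forall m m' n, b (m + m') n = b m n + b m' n.
Hypothesis bDr : forall m n n', b m (n + n') = b m n + b m n'.
Hypothesis bZ : forall r m n, b (r *: m) n = b m (r *: n).

Definition tlift (x : tensor) : G := \sum_(p <- trepr x) b p.1 p.2.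

Lemma tlift_class s : tlift (tclass s) = \sum_(p <- s) b p.1 p.2.
Proof.
have b0 n : b 0 n = 0 by apply: (addrI (b 0 n)); rewrite -bDl !addr0.
rewrite /tlift; move: (trepr _) (tclassK s) => t; elim=> {s t} //=.
- by move=> s t u _ -> _ ->.
- by move=> s s' t t' _ e _ e'; rewrite !big_cat /= e e'.
- by move=> s t; rewrite !big_cat /= addrC.
- by move=> n; rewrite big_seq1 big_nil b0.
- by move=> m m' n; rewrite big_seq1 big_cons big_seq1 bDl.
- by move=> m n n'; rewrite big_seq1 big_cons big_seq1 bDr.
- by move=> r m n; rewrite !big_seq1 bZ.
Qed.

Lemma tlift_tprod m n : tlift (tprod m n) = b m n.
Proof. by rewrite tlift_class big_seq1. Qed.

Lemma tliftD : {morph tlift : x y / x + y}.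
Proof.
move=> x y; rewrite -(treprK x) -(treprK y) -tclassD !tlift_class.
exact: big_cat.
Qed.

End Lift.

(* Two additive maps that agree on pure tensors are equal. *)
Lemma tensor_ext (G : zmodType) (f g : tensor -> G) :
  {morph f : x y / x + y} -> {morph g : x y / x + y} ->
  (forall m n, f (tprod m n) = g (tprod m n)) -> f =1 g.
Proof.
move=> fD gD fg x.
have f0 : f 0 = 0 by apply: (addrI (f 0)); rewrite -fD !addr0.
have g0 : g 0 = 0 by apply: (addrI (g 0)); rewrite -gD !addr0.
rewrite -(treprK x) tclass_sum (big_morph f fD f0) (big_morph g gD g0).
by apply: eq_bigr => p _.
Qed.

End Tensor.

(* The additive endomorphism h (x) N of M (x) N. *)
Section TensorMapLeft.
Variables (R : comPzRingType) (M N : lmodType R).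

Definition tmapl (h : M -> M) (x : tensor M N) : tensor M N :=
  tclass [seq (h p.1, p.2) | p <- trepr x].

Variable h : M -> M.
Hypothesis hD : {morph h : m m' / m + m'}.
Hypothesis hZ : forall r, {morph h : m / r *: m}.

Lemma tmaplE x : tmapl h x = tlift (fun m n => tprod (h m) n) x.
Proof. by rewrite /tmapl tclass_sum big_map. Qed.

Let bDl m m' (n : N) : tprod (h (m + m')) n = tprod (h m) n + tprod (h m') n.
Proof. by rewrite hD tprodDl. Qed.

Let bDr m (n n' : N) : tprod (h m) (n + n') = tprod (h m) n + tprod (h m) n'.
Proof. exact: tprodDr. Qed.

Let bZ r m (n : N) : tprod (h (r *: m)) n = tprod (h m) (r *: n).
Proof. by rewrite hZ tprodZ. Qed.

Lemma tmapl_tprod m n : tmapl h (tprod m n) = tprod (h m) n.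
Proof. by rewrite tmaplE tlift_tprod. Qed.

Lemma tmaplD : {morph tmapl h : x y / x + y}.
Proof. by move=> x y; rewrite !tmaplE tliftD. Qed.

End TensorMapLeft.

Section TensorLmod.
Variables (R : comPzRingType) (M N : lmodType R).

Let sD r : {morph *:%R r : m m' / m + m' :> M} := scalerDr r.
Let sZ r r' : {morph *:%R r : m / r' *: m :> M}.
Proof. by move=> m /=; rewrite !scalerA mulrC. Qed.

Fact tscaleDr : right_distributive (@tscale R M N) +%R.
Proof. by move=> r x y; exact: (tmaplD (@sD r) (@sZ r)). Qed.

Lemma tscale_tprod r m n : tscale r (tprod m n) = tprod (r *: m) n :> tensor M N.
Proof. exact: (tmapl_tprod (@sD r) (@sZ r)). Qed.

Fact tscaleA r r' x : tscale r (tscale r' x) = tscale (r * r') x :> tensor M N.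
Proof.
apply: (tensor_ext (f := tscale r \o tscale r')) => [y z|y z|m n] /=;
  by rewrite ?tscaleDr ?tscale_tprod ?scalerA.
Qed.

Fact tscale1 : left_id 1 (@tscale R M N).
Proof.
apply: (tensor_ext (g := id)) => [y z|y z|m n] //;
  by rewrite ?tscaleDr ?tscale_tprod ?scale1r.
Qed.

Fact tscaleDl (x : tensor M N) : {morph (@tscale R M N)^~ x : r r' / r + r'}.
Proof.
move=> r r'; apply: (tensor_ext (g := fun x => tscale r x + tscale r' x)).
- by move=> y z; rewrite tscaleDr.
- by move=> y z /=; rewrite !tscaleDr addrACA.
- by move=> m n; rewrite !tscale_tprod scalerDl tprodDl.
Qed.

HB.instance Definition _ := GRing.Zmodule_isLmodule.Build R (tensor M N)
  tscaleA tscale1 tscaleDr tscaleDl.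

End TensorLmod.

(* M (x) f : M (x) A -> M (x) B *)
Section TensorMapRight.
Variables (R : comPzRingType) (M A B : lmodType R) (f : {linear A -> B}).

Definition tmapr (x : tensor M A) : tensor M B :=
  tclass [seq (p.1, f p.2) | p <- trepr x].

Lemma tmaprE x : tmapr x = tlift (fun m a => tprod m (f a)) x.
Proof. by rewrite /tmapr tclass_sum big_map. Qed.

Let bDl (m m' : M) a : tprod (m + m') (f a) = tprod m (f a) + tprod m' (f a).
Proof. exact: tprodDl. Qed.

Let bDr (m : M) a a' : tprod m (f (a + a')) = tprod m (f a) + tprod m (f a').
Proof. by rewrite linearD tprodDr. Qed.

Let bZ r (m : M) a : tprod (r *: m) (f a) = tprod m (f (r *: a)).
Proof. by rewrite linearZ tprodZ. Qed.

Lemma tmapr_tprod m a : tmapr (tprod m a) = tprod m (f a).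
Proof. by rewrite tmaprE tlift_tprod. Qed.

Lemma tmaprD : {morph tmapr : x y / x + y}.
Proof. by move=> x y; rewrite !tmaprE tliftD. Qed.

End TensorMapRight.

Definition exact_at (A B C : zmodType) (f : A -> B) (g : B -> C) : Prop :=
  forall b, g b = 0 <-> exists a, f a = b.

Definition flat (R : comPzRingType) (M : lmodType R) : Prop :=
  forall (A B C : lmodType R) (f : {linear A -> B}) (g : {linear B -> C}),
    exact_at f g -> exact_at (@tmapr R M A B f) (@tmapr R M B C g).

Definition ring_epi (R S : comPzRingType) (phi : {rmorphism R -> S}) : Prop :=
  forall (T : comPzRingType) (f g : {rmorphism S -> T}),
    f \o phi =1 g \o phi -> f =1 g.

Definition flat_epi (R S : comPzRingType) (phi : {rmorphism R -> S}) : Prop :=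
  ring_epi phi /\ flat (restrict phi S^o).

(* [extend phi U] is S (x)_R U with S acting on the left factor; the alias
   keeps this S-module structure apart from the R-module structure carried by
   [tensor]. *)
Definition extend (R S : comPzRingType) (phi : {rmorphism R -> S})
  (U : lmodType R) : Type := tensor (restrict phi S^o) U.

Section Extend.
Variables (R S : comPzRingType) (phi : {rmorphism R -> S}) (U : lmodType R).

HB.instance Definition _ := GRing.Zmodule.on (extend phi U).

Definition lmul (s : S) (s' : restrict phi S^o) : restrict phi S^o :=
  s * (s' : S).

Definition extend_scale (s : S) (x : extend phi U) : extend phi U :=
  tmapl (lmul s) x.

Definition etprod (s : S) (u : U) : extend phi U :=
  @tprod R (restrict phi S^o) U s u.

Let sD s : {morph lmul s : m m' / m + m'}.
Proof. by move=> m m'; exact: mulrDr. Qed.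

Let sZ s r : {morph lmul s : m / r *: m}.
Proof. by move=> m; exact: mulrCA. Qed.

Fact extend_scalerDr : right_distributive extend_scale +%R.
Proof. by move=> s x y; exact: (tmaplD (@sD s) (@sZ s)). Qed.

Lemma extend_scale_tprod s s' u :
  extend_scale s (etprod s' u) = etprod (s * s') u.
Proof. exact: (tmapl_tprod (@sD s) (@sZ s)). Qed.

Fact extend_scalerA s s' x :
  extend_scale s (extend_scale s' x) = extend_scale (s * s') x.
Proof.
apply: (tensor_ext (f := extend_scale s \o extend_scale s'))
  => [y z|y z|m n] /=; first by rewrite !extend_scalerDr.
  by rewrite extend_scalerDr.
by rewrite !extend_scale_tprod mulrA.
Qed.

Fact extend_scale1r : left_id 1 extend_scale.
Proof.
apply: (tensor_ext (g := id)) => [y z|y z|m n] //.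
  by rewrite extend_scalerDr.
by rewrite extend_scale_tprod mul1r.
Qed.

Fact extend_scalerDl x : {morph extend_scale^~ x : s s' / s + s'}.
Proof.
move=> s s'.
apply: (tensor_ext (g := fun x => extend_scale s x + extend_scale s' x)).
- by move=> y z; rewrite extend_scalerDr.
- by move=> y z /=; rewrite !extend_scalerDr addrACA.
- by move=> m n; rewrite !extend_scale_tprod mulrDl; exact: tprodDl.
Qed.

HB.instance Definition _ := GRing.Zmodule_isLmodule.Build S (extend phi U)
  extend_scalerA extend_scale1r extend_scalerDr extend_scalerDl.

Definition ext_unit (u : U) : extend phi U := etprod 1 u.

Lemma extend_scaleE s s' u : s *: etprod s' u = etprod (s * s') u.
Proof. exact: extend_scale_tprod. Qed.

End Extend.

Definition theta (R : comPzRingType) (U V : lmodType R) (r : R) (e : U -> V) :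
  U -> V := fun u => r *: e u - e (r *: u).

Definition diff_op (K R : comPzRingType) (kappa : {rmorphism K -> R})
    (U V : lmodType R) (e : U -> V) : Prop :=
  linear (e : restrict kappa U -> restrict kappa V) /\
  forall r : R, exists n : nat, iter n.+1 (theta r) e =1 (fun _ => 0).

(* Main.v *)
(* A flat epimorphism has [s (x) 1 = 1 (x) s] in [S (x)_R S], and flatness turns
   this into fractions: for each [s] there are [r_i, a_i] in [R] and [c_i] in
   [S] with [phi(r_i) s = phi(a_i)] and [sum c_i phi(r_i) = 1].

   For maps [e : U -> S (x) V] put [(rho(r) e)(u) = e(r u)] and
   [theta_r = phi(r) - rho(r)].  On the bimodule generated by a differential
   operator every [theta_r] is locally nilpotent, hence
   [sum c_i rho(r_i) = 1 - sum c_i theta_(r_i)] is invertible there.  So an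
   element killed by all the [rho(r_i)] is zero, which gives uniqueness, and
   [rho(s) = (sum c_i rho(r_i))^-1 sum c_i rho(a_i)] makes sense; the extension
   is [D_S (s (x) u) = (rho(s) D_R)(u)]. *)
From HB Require Import structures.
From mathcomp Require Import all_boot all_algebra.
From mathcomp Require Import boolp functions.
(* Required last: [functions] has another [restrict]. *)
Require Import Defs.

Set Implicit Arguments.
Unset Strict Implicit.
Unset Printing Implicit Defensive.

Import GRing.Theory.
Local Open Scope ring_scope.

(** * Fractions along a flat epimorphism *)

(** An alias of the tensor product, so that the ring structure on [S (x)_R S] is attached to a type
    of its own. *)
Definition self_tensor (R S : comPzRingType) (phi : {rmorphism R -> S})
  : Type := tensor (restrict phi S^o) (restrict phi S^o).

Section SelfTensorRing.
Variables (R S : comPzRingType) (phi : {rmorphism R -> S}).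
Local Notation A := (restrict phi S^o).
Local Notation T := (self_tensor phi).

HB.instance Definition _ := GRing.Zmodule.on T.

Definition stprod (a b : S) : T := @tprod R A A a b.

Lemma stprodDl a a' b : stprod (a + a') b = stprod a b + stprod a' b.
Proof. exact: (@tprodDl R A A). Qed.

Lemma stprodDr a b b' : stprod a (b + b') = stprod a b + stprod a b'.
Proof. exact: (@tprodDr R A A). Qed.

Lemma stprodZ r a b : stprod (phi r * a) b = stprod a (phi r * b).
Proof. exact: (@tprodZ R A A). Qed.

(** Multiplication by the pure tensor [a (x) b]. The product is lifted one factor at a time. *)
Definition stmul1 (a b : S) (y : T) : T :=
  tlift (fun c d : A => stprod (a * c) (b * d)) y.

Lemma stmul1_tprod a b c d :
  stmul1 a b (stprod c d) = stprod (a * c) (b * d).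
Proof.
apply: (@tlift_tprod R A A) => [m m' n|m n n'|r m n].
- by rewrite mulrDr stprodDl.
- by rewrite mulrDr stprodDr.
- by rewrite [a * _]mulrCA stprodZ mulrCA.
Qed.

Lemma stmul1D a b : {morph stmul1 a b : y y' / y + y'}.
Proof.
apply: (@tliftD R A A) => [m m' n|m n n'|r m n].
- by rewrite mulrDr stprodDl.
- by rewrite mulrDr stprodDr.
- by rewrite [a * _]mulrCA stprodZ mulrCA.
Qed.

Lemma self_tensor_ext (G : zmodType) (f g : T -> G) :
    {morph f : x y / x + y} -> {morph g : x y / x + y} ->
  (forall a b, f (stprod a b) = g (stprod a b)) -> f =1 g.
Proof. exact: (@tensor_ext R A A). Qed.

Lemma stmul1Dl a a' b y : stmul1 (a + a') b y = stmul1 a b y + stmul1 a' b y.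
Proof.
apply: (self_tensor_ext (g := fun y => stmul1 a b y + stmul1 a' b y)).
- exact: stmul1D.
- by move=> x z; rewrite !stmul1D addrACA.
- by move=> c d; rewrite !stmul1_tprod mulrDl stprodDl.
Qed.

Lemma stmul1Dr a b b' y : stmul1 a (b + b') y = stmul1 a b y + stmul1 a b' y.
Proof.
apply: (self_tensor_ext (g := fun y => stmul1 a b y + stmul1 a b' y)).
- exact: stmul1D.
- by move=> x z; rewrite !stmul1D addrACA.
- by move=> c d; rewrite !stmul1_tprod mulrDl stprodDr.
Qed.

Lemma stmul1Z r a b y : stmul1 (phi r * a) b y = stmul1 a (phi r * b) y.
Proof.
apply: self_tensor_ext; try exact: stmul1D.
by move=> c d; rewrite !stmul1_tprod -!mulrA stprodZ.
Qed.

Definition stmul (x y : T) : T := tlift (fun a b : A => stmul1 a b y) x.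

Lemma stmul_tprod a b y : stmul (stprod a b) y = stmul1 a b y.
Proof.
apply: (@tlift_tprod R A A) => [m m' n|m n n'|r m n].
- exact: stmul1Dl.
- exact: stmul1Dr.
- exact: stmul1Z.
Qed.

Lemma stmulDl : left_distributive stmul +%R.
Proof.
move=> x x' y; apply: (@tliftD R A A) => [m m' n|m n n'|r m n].
- exact: stmul1Dl.
- exact: stmul1Dr.
- exact: stmul1Z.
Qed.

Lemma stmulDr x y y' : stmul x (y + y') = stmul x y + stmul x y'.
Proof.
move: x; apply: (self_tensor_ext (g := fun x => stmul x y + stmul x y')).
- by move=> x x'; rewrite stmulDl.
- by move=> x x'; rewrite !stmulDl addrACA.
- by move=> a b; rewrite !stmul_tprod stmul1D.
Qed.

Lemma stmulC : commutative stmul.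
Proof.
move=> x y; move: x; apply: (self_tensor_ext (f := stmul^~ y)).
- by move=> x x'; rewrite stmulDl.
- by move=> x x'; rewrite stmulDr.
move=> a b; move: y; apply: self_tensor_ext.
- by move=> x x'; rewrite stmulDr.
- by move=> x x'; rewrite stmulDl.
by move=> c d; rewrite !stmul_tprod !stmul1_tprod mulrC [b * d]mulrC.
Qed.

Lemma stmulA : associative stmul.
Proof.
move=> x y z; move: x.
apply: (self_tensor_ext (g := fun x => stmul (stmul x y) z)).
- by move=> x x'; rewrite stmulDl.
- by move=> x x'; rewrite !stmulDl.
move=> a b; move: y.
apply: (self_tensor_ext (f := fun y => stmul (stprod a b) (stmul y z))
                        (g := fun y => stmul (stmul (stprod a b) y) z)).
- by move=> x x'; rewrite stmulDl stmulDr.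
- by move=> x x'; rewrite stmulDr stmulDl.
move=> c d; move: z; apply: self_tensor_ext.
- by move=> x x'; rewrite !stmulDr.
- by move=> x x'; rewrite !stmulDr.
by move=> e f; rewrite !(stmul_tprod, stmul1_tprod) !mulrA.
Qed.

Lemma stmul1r : left_id (stprod 1 1) stmul.
Proof.
apply: (self_tensor_ext (g := id)) => //.
  by move=> x x'; rewrite stmulDr.
by move=> a b; rewrite stmul_tprod stmul1_tprod !mul1r.
Qed.

HB.instance Definition _ := GRing.Zmodule_isComPzRing.Build T
  stmulA stmulC stmul1r stmulDl.

Lemma stprodM a b c d : stprod a b * stprod c d = stprod (a * c) (b * d).
Proof. by rewrite -stmul1_tprod -stmul_tprod. Qed.

Definition inl_tensor (s : S) : T := stprod s 1.
Definition inr_tensor (s : S) : T := stprod 1 s.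

Fact inl_tensorD : nmod_morphism inl_tensor.
Proof.
split=> [|x y]; last exact: stprodDl.
by apply: (addrI (inl_tensor 0)); rewrite -stprodDl !addr0.
Qed.
Fact inr_tensorD : nmod_morphism inr_tensor.
Proof.
split=> [|x y]; last exact: stprodDr.
by apply: (addrI (inr_tensor 0)); rewrite -stprodDr !addr0.
Qed.
Fact inl_tensorM : monoid_morphism inl_tensor.
Proof. by split=> // x y; rewrite stprodM mulr1. Qed.
Fact inr_tensorM : monoid_morphism inr_tensor.
Proof. by split=> // x y; rewrite stprodM mulr1. Qed.

HB.instance Definition _ :=
  GRing.isNmodMorphism.Build S T inl_tensor inl_tensorD.
HB.instance Definition _ :=
  GRing.isNmodMorphism.Build S T inr_tensor inr_tensorD.
HB.instance Definition _ :=
  GRing.isMonoidMorphism.Build S T inl_tensor inl_tensorM.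
HB.instance Definition _ :=
  GRing.isMonoidMorphism.Build S T inr_tensor inr_tensorM.

(** The two inclusions of [S] into [S (x)_R S] agree on the image of [R]; an epimorphism forces them
    to be equal. *)
Lemma ring_epi_stprodC : ring_epi phi -> forall s, stprod s 1 = stprod 1 s.
Proof.
move=> epi; apply: (epi T inl_tensor inr_tensor) => r /=.
by rewrite -[phi r]mulr1 /inl_tensor stprodZ.
Qed.

End SelfTensorRing.

(** * Flatness and kernels *)

Section FlatKernel.
Variables (R : comPzRingType) (M B C : lmodType R) (g : {linear B -> C}).

Definition lin_ker : {pred B} := fun b => g b == 0.

Fact lin_ker_submod : submod_closed lin_ker.
Proof.
split=> [|a u v]; first by rewrite unfold_in linear0.
by rewrite !unfold_in linearP => /eqP-> /eqP->; rewrite scaler0 addr0.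
Qed.

HB.instance Definition _ :=
  GRing.isSubmodClosed.Build R B lin_ker lin_ker_submod.

Record ker_type : Type := KerType {ker_val : B; _ : ker_val \in lin_ker}.
HB.instance Definition _ := [isSub for ker_val].
HB.instance Definition _ := [Choice of ker_type by <:].
HB.instance Definition _ := [SubChoice_isSubLmodule of ker_type by <:].

(** Flatness keeps [ker g -> B -> C] exact after tensoring with [M], so [x] comes from a tensor over
    [ker g]; [l] is a representative of that tensor. *)
Lemma flat_ker (x : tensor M B) : flat M -> tmapr g x = 0 ->
  exists2 l : seq (M * B),
    (forall p, p \in l -> g p.2 = 0) & x = \sum_(p <- l) tprod p.1 p.2.
Proof.
move=> fM; have /(fM _ _ _ (val : {linear ker_type -> B}) g) ex :
    exact_at (val : ker_type -> B) g.
  move=> b; split=> [gb|[[a ha] <-]]; last exact/eqP.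
  have kb : b \in lin_ker by exact/eqP.
  by exists (KerType kb).
move/ex=> [y <-]; rewrite /tmapr tclass_sum.
exists [seq (p.1, val p.2) | p <- trepr y] => // p /mapP[[m [a ha]] _ ->].
exact/eqP.
Qed.

End FlatKernel.

(** * Denominators and annihilators of a flat epimorphism *)

Section FlatEpi.
Variables (R S : comPzRingType) (phi : {rmorphism R -> S}).
Hypothesis phi_epi : flat_epi phi.
Local Notation A := (restrict phi S^o).

Lemma flat_epi_stprod a b : stprod phi a b = stprod phi (a * b) 1.
Proof.
rewrite -[a in LHS]mulr1 -[b in LHS]mul1r -stprodM.
by rewrite -(ring_epi_stprodC phi_epi.1) stprodM mulr1.
Qed.

Lemma bilinear_eval (B : lmodType R) (h : {linear B -> A}) (l m : seq (A * B)) :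
    @tclass R A B l = tclass m ->
  \sum_(p <- l) (p.1 : S) * (h p.2 : S) =
  \sum_(p <- m) (p.1 : S) * (h p.2 : S).
Proof.
have hlift := @tlift_class R A B S (fun a b => (a : S) * (h b : S)).
move=> lm; rewrite -!hlift ?lm //; try by move=> *; exact: mulrDl.
- by move=> n b b'; rewrite linearD; exact: mulrDr.
- move=> r n b; rewrite linearZ -[r *: n]/(phi r * (n : S)).
  by rewrite -mulrA mulrCA.
- by move=> n b b'; rewrite linearD; exact: mulrDr.
- move=> r n b; rewrite linearZ -[r *: n]/(phi r * (n : S)).
  by rewrite -mulrA mulrCA.
Qed.

(** An equational form of flatness: the tensor of [m] is rewritten with entries in [ker g], and the
    value of [n (x) b |-> n h(b)] does not change. The map [h] serves to read off the relation
    wanted. *)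
Lemma flat_rel (B C : lmodType R) (g : {linear B -> C}) (h : {linear B -> A})
    (m : seq (A * B)) :
    \sum_(p <- m) tprod p.1 (g p.2) = 0 ->
  exists2 l : seq (A * B), forall p, p \in l -> g p.2 = 0 &
    \sum_(p <- l) (p.1 : S) * (h p.2 : S) =
    \sum_(p <- m) (p.1 : S) * (h p.2 : S).
Proof.
move=> gm; have [|l lker lE] := @flat_ker R A B C g (tclass m) phi_epi.2.
  rewrite tmaprE tlift_class => [//|n n' b|n b b'|r n b].
  - exact: tprodDl.
  - by rewrite linearD tprodDr.
  - by rewrite linearZ tprodZ.
by exists l => //; apply: bilinear_eval; rewrite lE tclass_sum.
Qed.

Definition rmorph_lin (b : R^o) : A := phi b.
Fact rmorph_lin_linear : linear rmorph_lin.
Proof. by move=> a u v; rewrite /rmorph_lin rmorphD rmorphM. Qed.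
HB.instance Definition _ :=
  GRing.isLinear.Build R R^o A *:%R rmorph_lin rmorph_lin_linear.

(** The kernel consists of the pairs [(r, a)] that present [s] as a fraction [a / r]. *)
Definition den_lin (s : S) (b : R^o * R^o) : A := phi b.1 * s - phi b.2.
Fact den_lin_linear s : linear (den_lin s).
Proof.
move=> a u v; rewrite /den_lin !rmorphD !rmorphM /= -[a *: _]/(phi a * _).
by rewrite mulrDl mulrBr -mulrA addrACA opprD.
Qed.
HB.instance Definition _ s :=
  GRing.isLinear.Build R (R^o * R^o)%type A *:%R (den_lin s) (den_lin_linear s).

Definition mulr_lin (x : R) (b : R^o) : R^o := b * x.
Fact mulr_lin_linear x : linear (mulr_lin x).
Proof. by move=> a u v; rewrite /mulr_lin mulrDl -mulrA. Qed.
HB.instance Definition _ x :=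
  GRing.isLinear.Build R R^o R^o *:%R (mulr_lin x) (mulr_lin_linear x).

Lemma flat_epi_denominators s :
  exists2 l : seq (S * (R * R)),
    forall p, p \in l -> phi p.2.1 * s = phi p.2.2 &
    \sum_(p <- l) p.1 * phi p.2.1 = 1.
Proof.
(* The image of [m] under [den_lin s] is [1 (x) s - s (x) 1], which vanishes for an epimorphism; its
   value under the first projection is 1. *)
pose m : seq (A * (R^o * R^o)) := [:: (1 : S, (1, 0)); (s, (0, 1))].
have [|l lker lE] := @flat_rel _ _ (den_lin s) (rmorph_lin \o fst) m.
  rewrite big_cons big_seq1.
  change (stprod phi 1 (phi 1 * s - phi 0) +
          stprod phi s (phi 0 * s - phi 1) = 0).
  rewrite !(flat_epi_stprod _ (_ - _)) -stprodDl rmorph1 rmorph0 !mul1r mul0r.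
  by rewrite subr0 sub0r mulrN1 subrr -[LHS]/(inl_tensor phi 0) raddf0.
exists l; first by move=> p /lker/eqP; rewrite subr_eq0 => /eqP.
rewrite [LHS]lE !big_cons big_nil /= /rmorph_lin rmorph1 rmorph0.
by rewrite mulr0 !addr0 mulr1.
Qed.

(** In [S (x)_R R] one has [1 (x) (x - y) = phi(x - y) (x) 1 = 0]. Flatness, applied to
    multiplication by [x - y], shows that the annihilator of [x - y] generates the unit ideal of
    [S]. *)
Lemma flat_epi_annihilators x y : phi x = phi y ->
  exists2 l : seq (S * R), forall p, p \in l -> p.2 * x = p.2 * y &
    \sum_(p <- l) p.1 * phi p.2 = 1.
Proof.
move=> xy; pose m : seq (A * R^o) := [:: (1 : S, 1)].
have [|l lker lE] := @flat_rel _ _ (mulr_lin (x - y)) rmorph_lin m.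
  rewrite big_seq1; change (tprod (1 : A) ((1 * (x - y)) : R^o) = 0).
  rewrite mulrC -[_ * _]/((x - y) *: (1 : R^o)) -tprodZ.
  have -> : (x - y) *: (1 : A) = 0.
    by rewrite -[LHS]/(phi (x - y) * 1) rmorphB xy subrr mul0r.
  by apply: (addrI (tprod (0 : A) (1 : R^o))); rewrite -tprodDl !addr0.
exists l.
  by move=> p /lker/eqP; rewrite /= /mulr_lin mulrBr subr_eq0 => /eqP.
by rewrite [LHS]lE big_seq1 mul1r; exact: rmorph1.
Qed.

End FlatEpi.

(** * Locally nilpotent elements of a bimodule *)

Section Bimodule.
Variables (R S : comPzRingType) (phi : {rmorphism R -> S}).
Variables (E : lmodType S) (rho : R -> E -> E).
Hypothesis rhoD : forall r, {morph rho r : x y / x + y}.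
Hypothesis rhoZ : forall r s, {morph rho r : x / s *: x}.
Hypothesis rhoM : forall r r' x, rho (r * r') x = rho r (rho r' x).

(** The operators by which [S (x) R] acts on [E]; the values [f m] with [bop f] form the
    sub-bimodule generated by [m]. *)
Inductive bop : (E -> E) -> Prop :=
| bop_scale s : bop ( *:%R s)
| bop_rho r : bop (rho r)
| bop_add f g : bop f -> bop g -> bop (fun x => f x + g x)
| bop_comp f g : bop f -> bop g -> bop (f \o g).

Lemma bop0 : bop (fun=> 0).
Proof.
by have := bop_scale 0; congr bop; apply: funext => x; rewrite scale0r.
Qed.

Lemma bopZ s f : bop f -> bop (fun x => s *: f x).
Proof. by move=> ?; apply: (@bop_comp ( *:%R s)) => //; exact: bop_scale. Qed.

Lemma bop_sub f g : bop f -> bop g -> bop (fun x => f x - g x).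
Proof.
move=> bf bg; have := bop_add bf (bopZ (-1) bg).
by congr bop; apply: funext => x; rewrite scaleN1r.
Qed.

Lemma bop_sum (I : Type) (l : seq I) (f : I -> E -> E) :
  (forall i, bop (f i)) -> bop (fun x => \sum_(i <- l) f i x).
Proof.
move=> bf; elim: l => [|i l IHl].
  by have := bop0; congr bop; apply: funext => x; rewrite big_nil.
have := bop_add (bf i) IHl.
by congr bop; apply: funext => x; rewrite big_cons.
Qed.

Lemma bopD f : bop f -> {morph f : x y / x + y}.
Proof.
elim=> {f} [s|r|f g _ fD _ gD|f g _ fD _ gD] x y /=; rewrite ?scalerDr ?rhoD //.
  by rewrite fD gD addrACA.
by rewrite gD fD.
Qed.

Lemma bop_at0 f : bop f -> f 0 = 0.
Proof. by move=> bf; apply: (addrI (f 0)); rewrite -(bopD bf) !addr0. Qed.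

Lemma bopC f g : bop f -> bop g -> forall x, f (g x) = g (f x).
Proof.
move=> bf; elim=> {g} [s|r|g h bg fg bh fh|g h bg fg bh fh] x /=.
- elim: bf x => {f} [s'|r|f g _ fC _ gC|f g _ fC _ gC] x //=.
  + by rewrite !scalerA mulrC.
  + by rewrite rhoZ.
  + by rewrite fC gC scalerDr.
  + by rewrite gC fC.
- elim: bf x => {f} [s|r'|f g _ fC _ gC|f g _ fC _ gC] x //=.
  + by rewrite rhoZ.
  + by rewrite -!rhoM mulrC.
  + by rewrite fC gC rhoD.
  + by rewrite gC fC.
- by rewrite (bopD bf) fg fh.
- by rewrite fg fh.
Qed.

Lemma bop_iterC f g n x : bop f -> bop g -> iter n f (g x) = g (iter n f x).
Proof. by move=> bf bg; elim: n => //= n ->; exact: (bopC bf bg). Qed.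

Lemma bop_iter0 f n : bop f -> iter n f 0 = 0.
Proof. by move=> bf; elim: n => //= n ->; exact: (bop_at0 bf). Qed.

Definition nil_at (f : E -> E) (x : E) := exists n, iter n f x = 0.

Lemma nil_at_add f g x : bop f -> bop g ->
  nil_at f x -> nil_at g x -> nil_at (fun y => f y + g y) x.
Proof.
move=> bf bg [a fa] [b gb]; exists (a + b)%N; set h := fun y => _.
have bh : bop h := bop_add bf bg.
(* This replaces the binomial formula: one application of [h] turns [y] into [f y + g y], and each
   summand needs one exponent fewer, [c] for [f y] and [d] for [g y]. *)
suff claim k c d y : (c + d <= k)%N ->
    iter c f y = 0 -> iter d g y = 0 -> iter k h y = 0 by exact: (claim _ a b).
elim: k c d y {a b x fa gb} => [|k IHk] [|a] [|b] x //= kE fa gb;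
  try by rewrite -iterS ?fa ?gb bop_iter0.
have iD u v : iter k h (u + v) = iter k h u + iter k h v.
  by elim: k {IHk kE} => //= k ->; rewrite (bopD bh).
have kE1 : (a + b.+1 <= k)%N by rewrite -ltnS -addSn.
have kE2 : (a.+1 + b <= k)%N by rewrite addSnnS.
rewrite -iterS iterSr iD (IHk a b.+1 _ kE1) ?(IHk a.+1 b _ kE2) ?addr0 //.
all: rewrite -?iterSr //.
- by rewrite bop_iterC //= fa bop_at0.
- by rewrite bop_iterC //= gb bop_at0.
Qed.

Lemma nil_at_comp f g x : bop f -> bop g -> nil_at f x -> nil_at (g \o f) x.
Proof.
move=> bf bg [n fn]; exists n.
suff -> : iter n (g \o f) x = iter n g (iter n f x) by rewrite fn bop_iter0.
elim: n {fn} => //= n ->; congr g.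
by rewrite (bop_iterC _ _ bg bf).
Qed.

Lemma nil_at_image f g x : bop f -> bop g -> nil_at f x -> nil_at f (g x).
Proof. by move=> bf bg [n fn]; exists n; rewrite bop_iterC // fn bop_at0. Qed.

Lemma nil_at_sum (I : Type) (l : seq I) (f : I -> E -> E) x :
    (forall i, bop (f i)) -> (forall i, nil_at (f i) x) ->
  nil_at (fun y => \sum_(i <- l) f i y) x.
Proof.
move=> bf nf; elim: l => [|i l IHl].
  by exists 1%N; rewrite /= big_nil.
have := nil_at_add (bf i) (bop_sum l bf) (nf i) IHl.
by congr nil_at; apply: funext => y; rewrite big_cons.
Qed.

Lemma rhoB t x y : rho t (x - y) = rho t x - rho t y.
Proof. by rewrite -scaleN1r rhoD rhoZ scaleN1r. Qed.

Definition bitheta r x := phi r *: x - rho r x.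

Lemma bop_theta r : bop (bitheta r).
Proof. by apply: bop_sub; [exact: bop_scale|exact: bop_rho]. Qed.

Definition locnil x := forall r, nil_at (bitheta r) x.

Lemma locnil_image g x : bop g -> locnil x -> locnil (g x).
Proof. by move=> bg nx r; apply: nil_at_image => //; exact: bop_theta. Qed.

Lemma locnil_add x y : locnil x -> locnil y -> locnil (x + y).
Proof.
move=> nx ny r; have [[a xa] [b yb]] := (nx r, ny r); exists (a + b)%N.
have iD n : {morph iter n (bitheta r) : u v / u + v}.
  by elim: n => // n IHn u v /=; rewrite IHn (bopD (bop_theta r)).
rewrite iD [iter _ _ y]iterD yb addnC iterD xa.
by rewrite !bop_iter0 ?addr0 //; exact: bop_theta.
Qed.

Lemma locnil_comb (I : Type) (l : seq I) (c : I -> S) (d : I -> R) x :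
  locnil x -> nil_at (fun y => \sum_(i <- l) c i *: bitheta (d i) y) x.
Proof.
move=> nx; apply: nil_at_sum => i; first exact/bopZ/bop_theta.
by apply: nil_at_comp => //; [exact: bop_theta|exact: bop_scale].
Qed.

Lemma bop_comb (I : Type) (l : seq I) (c : I -> S) (d : I -> R) :
  bop (fun y => \sum_(i <- l) c i *: bitheta (d i) y).
Proof. by apply: bop_sum => i; exact/bopZ/bop_theta. Qed.

(* Since [sum c_i phi(d_i) = 1], the operator [sum c_i rho(d_i)] is the
   identity minus the locally nilpotent [sum c_i theta(d_i)]. *)
Lemma comb_unitE (I : Type) (l : seq I) (c : I -> S) (d : I -> R) x :
    \sum_(i <- l) c i * phi (d i) = 1 ->
  x - \sum_(i <- l) c i *: bitheta (d i) x = \sum_(i <- l) c i *: rho (d i) x.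
Proof.
move=> l1; rewrite -{1}[x]scale1r -l1 scaler_suml -sumrB; apply: eq_bigr => i _.
by rewrite -scalerA -scalerBr /bitheta opprB addrC subrK.
Qed.

(** With [N = sum c_i theta(d_i)] the last hypothesis reads [x = N x], hence [x = N^n x = 0] for
    large [n]. *)
Lemma locnil_cancel (I : Type) (l : seq I) (c : I -> S) (d : I -> R) x :
    \sum_(i <- l) c i * phi (d i) = 1 -> locnil x ->
  \sum_(i <- l) c i *: rho (d i) x = 0 -> x = 0.
Proof.
move=> l1 nx; rewrite -(comb_unitE x l1) => /eqP; rewrite subr_eq0 => /eqP xN.
have [n] := locnil_comb l c d nx.
by elim: n => // n IHn; rewrite iterSr -xN.
Qed.

(** The geometric series [f + N f + N^2 f + ...] terminates at [m] and inverts [1 - N] there.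
    Building it by induction keeps the solution within [bop]. *)
Lemma comb_invert N m f : bop N -> nil_at N m -> bop f ->
  exists2 g, bop g & g m - N (g m) = f m.
Proof.
move=> bN [n Nn] bf; have {Nn}: iter n N (f m) = 0.
  by rewrite bop_iterC // Nn bop_at0.
elim: n f bf => [|n IHn] f bf /= Nn.
  by exists (fun=> 0); [exact: bop0|rewrite (bop_at0 bN) subrr Nn].
have [|g bg gE] := IHn (N \o f) (bop_comp bN bf); first by rewrite -iterSr.
exists (fun x => f x + g x); first exact: bop_add.
by rewrite (bopD bN) opprD addrACA gE /= subrK.
Qed.

Hypothesis phi_epi : flat_epi phi.

(** The difference is killed by [rho d] for every [d] annihilating [a - b], and such [d] generate
    the unit ideal of [S]. *)
Lemma locnil_ker a b m : locnil m -> phi a = phi b -> rho a m = rho b m.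
Proof.
move=> nm /(flat_epi_annihilators phi_epi)[l lab l1].
apply/eqP; rewrite -subr_eq0; apply/eqP; apply: (locnil_cancel l1).
  apply: (locnil_image (g := fun x => rho a x - rho b x)) nm.
  by apply: bop_sub; exact: bop_rho.
rewrite big_seq big1 // => p pl.
by rewrite rhoB -!rhoM lab // subrr scaler0.
Qed.

(** The value [f m] plays the role of [rho(s) m]: it solves [sum c_i rho(r_i) (f m) = sum c_i
    rho(a_i) m] for the fractions [a_i / r_i] of [s]. *)
Lemma locnil_rmul m s : locnil m ->
  exists2 f, bop f & forall r a, phi r * s = phi a -> rho r (f m) = rho a m.
Proof.
move=> nm; have [l ls l1] := flat_epi_denominators phi_epi s.
have [|g bg gE] := @comb_invert _ m (fun x => \sum_(p <- l) p.1 *: rho p.2.2 x)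
    (bop_comb l fst (fst \o snd)) (locnil_comb l fst (fst \o snd) nm).
  by apply: bop_sum => p; exact/bopZ/bop_rho.
rewrite comb_unitE // in gE.
exists g => // r a ra; apply/eqP; rewrite -subr_eq0; apply/eqP.
apply: (locnil_cancel (c := fst) (d := fst \o snd) l1).
  apply: (locnil_image (g := fun x => rho r (g x) - rho a x)) nm.
  by apply: bop_sub (bop_rho a); exact: (bop_comp (bop_rho r)).
under eq_bigr do rewrite rhoB scalerBr -rhoM mulrC rhoM -rhoZ.
rewrite sumrB -(big_morph _ (rhoD r) (bop_at0 (bop_rho r))) gE.
rewrite (big_morph _ (rhoD r) (bop_at0 (bop_rho r))) -sumrB big_seq.
rewrite big1 // => p pl; rewrite rhoZ -!rhoM -scalerBr.
(* The elements [r a_i] and [r_i a] may differ in [R], but [phi] sends both to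
   [phi(r) phi(r_i) s]. *)
rewrite (locnil_ker (b := p.2.1 * a) nm) ?subrr ?scaler0 //.
by rewrite !rmorphM -ra -ls //= mulrCA.
Qed.

End Bimodule.

(** * Local nilpotency over [S] from local nilpotency over [R] *)

Section BimoduleOverS.
Variables (R S : comPzRingType) (phi : {rmorphism R -> S}).
Variables (E : lmodType S) (rho : S -> E -> E).
Hypothesis rhoD : forall r, {morph rho r : x y / x + y}.
Hypothesis rhoZ : forall r s, {morph rho r : x / s *: x}.
Hypothesis rhoM : forall r r' x, rho (r * r') x = rho r (rho r' x).
Hypothesis phi_epi : flat_epi phi.
Local Notation theta_ := (bitheta (idfun : {rmorphism S -> S}) rho).

(* If [phi(r_i) t = phi(a_i)] and [sum c_i phi(r_i) = 1], then
   [theta_t = sum c_i phi(r_i) theta_t] with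
   [phi(r) theta_t = theta_r theta_t - t theta_r + theta_a]. *)
Lemma locnil_flat_epi x :
  (forall r, nil_at (theta_ (phi r)) x) -> locnil idfun rho x.
Proof.
move=> nx t; have [l lt l1] := flat_epi_denominators phi_epi t.
have bt s : bop rho (theta_ s) by exact: bop_theta.
pose f (p : S * (R * R)) y := p.1 *: (theta_ (phi p.2.1) (theta_ t y)
  + - t *: theta_ (phi p.2.1) y + theta_ (phi p.2.2) y).
have -> : theta_ t = fun y => \sum_(p <- l) f p y.
  apply: funext => y; rewrite -[LHS]scale1r -l1 scaler_suml.
  apply: eq_big_seq => p pl.
  rewrite -scalerA; congr (_ *: _); rewrite {1}/bitheta.
  rewrite /bitheta /= (rhoB rhoD rhoZ) rhoZ -rhoM (lt p pl) scaleNr.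
  rewrite (scalerBr t) scalerA [t * _]mulrC (lt p pl) !opprB -!addrA !addKr.
  by rewrite subrr addr0.
have nt r g : bop rho g -> nil_at (fun z => g (theta_ (phi r) z)) x.
  by move=> bg; apply: (nil_at_comp rhoD rhoZ rhoM (bt (phi r)) bg).
have bcomp g h : bop rho g -> bop rho h -> bop rho (fun z => g (h z)).
  by move=> bg bh; apply: (bop_comp bg bh).
have b1 r : bop rho (fun z => theta_ (phi r) (theta_ t z)) by apply: bcomp.
have b2 r : bop rho (fun z => - t *: theta_ (phi r) z) by apply: bopZ.
have b3 (p : S * (R * R)) :=
  bop_add (bop_add (b1 p.2.1) (b2 p.2.1)) (bt (phi p.2.2)).
apply: (nil_at_sum rhoD rhoZ rhoM) => p; first exact/bopZ/b3.
apply: (nil_at_comp rhoD rhoZ rhoM (b3 p) (bop_scale rho p.1)).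
apply: nil_at_add => //; first exact: bop_add.
apply: nil_at_add => //; last by apply: nt; exact: bop_scale.
have := nt p.2.1 _ (bt t); congr nil_at; apply: funext => z.
exact: (bopC rhoD rhoZ rhoM (bt _) (bt _)).
Qed.

End BimoduleOverS.

(** * Extension of differential operators *)

Section Precomposition.
Variables (R S : comPzRingType) (U : lmodType R) (W : lmodType S).

(** The right action [rho] of [R], taken on all functions so that their pointwise module structure
    serves as [E]. Linearity is tracked apart, by [lin_along]. *)
Definition prescale (r : R) (e : U -> W) : U -> W := fun u => e (r *: u).

Lemma prescaleD r : {morph prescale r : x y / x + y}.
Proof. by []. Qed.

Lemma prescaleZ r s : {morph prescale r : x / s *: x}.
Proof. by []. Qed.

Lemma prescaleM r r' e : prescale (r * r') e = prescale r (prescale r' e).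
Proof. by apply: funext => u; rewrite /prescale scalerA mulrC. Qed.

Definition lin_along (K : comPzRingType) (kappa : {rmorphism K -> R})
    (psi : {rmorphism K -> S}) (e : U -> W) :=
  {morph e : u v / u + v} /\ forall k u, e (kappa k *: u) = psi k *: e u.

Lemma bop_lin_along (K : comPzRingType) (kappa : {rmorphism K -> R})
    (psi : {rmorphism K -> S}) f e :
  bop prescale f -> lin_along kappa psi e -> lin_along kappa psi (f e).
Proof.
move=> bf; elim: bf e => {f} [s|r|f g _ fL _ gL|f g _ fL _ gL] e eL /=.
- case: eL => eD eZ; split=> [u v|k u]; rewrite !fctE ?eD ?scalerDr //.
  by rewrite eZ !scalerA mulrC.
- case: eL => eD eZ; split=> [u v|k u]; rewrite /prescale ?scalerDr ?eD //.
  by rewrite scalerA mulrC -scalerA eZ.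
- have [[fD fZ] [gD gZ]] := (fL e eL, gL e eL).
  split=> [u v|k u]; rewrite !fctE; first by rewrite fD gD addrACA.
  by rewrite fZ gZ scalerDr.
- exact/fL/gL.
Qed.

End Precomposition.

Lemma etprodZ (R S : comPzRingType) (phi : {rmorphism R -> S}) (V : lmodType R)
  (s : S) (r : R) (v : V) : etprod phi s (r *: v) = etprod phi (phi r * s) v.
Proof. exact/esym/(@tprodZ R (restrict phi S^o) V). Qed.

Section ExtUnit.
Variables (R S : comPzRingType) (phi : {rmorphism R -> S}) (V : lmodType R).

Lemma ext_unitD (v w : V) :
  ext_unit phi (v + w) = ext_unit phi v + ext_unit phi w.
Proof. exact: (@tprodDr R (restrict phi S^o) V). Qed.

Lemma ext_unitZ (r : R) (v : V) :
  ext_unit phi (r *: v) = phi r *: ext_unit phi v.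
Proof. by rewrite /ext_unit etprodZ extend_scaleE. Qed.

Lemma ext_unitB (v w : V) :
  ext_unit phi (v - w) = ext_unit phi v - ext_unit phi w.
Proof. by rewrite -scaleN1r ext_unitD ext_unitZ rmorphN1 scaleN1r. Qed.

End ExtUnit.

Section ExtendDiff.
Variables (R S : comPzRingType) (phi : {rmorphism R -> S}).
Variables (U V : lmodType R) (W : lmodType S).

Lemma iter_bitheta_unit (D : U -> V) r n :
  iter n (bitheta phi (@prescale R S U (extend phi V)) r)
    (ext_unit phi (U:=V) \o D) =
  ext_unit phi (U:=V) \o iter n (theta r) D.
Proof.
elim: n => //= n ->; apply: funext => u /=.
by rewrite /theta /= ext_unitB ext_unitZ.
Qed.

(** The slices along [s (x) U] reduce statements on maps out of [S (x) U] to maps out of [U]. *)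
Definition at_scalar (s : S) (e : extend phi U -> W) : U -> W :=
  fun u => e (etprod phi s u).

Lemma iter_bitheta_at_scalar (e : extend phi U -> W) s r n :
  at_scalar s (iter n (bitheta (idfun : {rmorphism S -> S})
    (@prescale S S _ W) (phi r)) e) =
  iter n (bitheta phi (@prescale R S U W) r) (at_scalar s e).
Proof.
elim: n => //= n <-; apply: funext => u.
rewrite /at_scalar /bitheta !fctE; congr (_ - _).
by rewrite /prescale extend_scaleE etprodZ.
Qed.

Lemma extend_ext (e e' : extend phi U -> W) :
    {morph e : x y / x + y} -> {morph e' : x y / x + y} ->
  (forall s, at_scalar s e = at_scalar s e') -> e = e'.
Proof.
move=> eD e'D ee'; apply: funext.
by apply: tensor_ext => // s u; exact: (congr1 (@^~ u) (ee' s)).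
Qed.

End ExtendDiff.

Lemma iter_bitheta_theta (S : comPzRingType) (U W : lmodType S) (s : S) n
    (e : U -> W) :
  iter n (bitheta (idfun : {rmorphism S -> S}) (@prescale S S U W) s) e =
  iter n (theta s) e.
Proof. by []. Qed.

Lemma lin_alongP (K R S : comPzRingType) (kappa : {rmorphism K -> R})
    (psi : {rmorphism K -> S}) (U : lmodType R) (W : lmodType S) (e : U -> W) :
  linear (e : restrict kappa U -> restrict psi W) <-> lin_along kappa psi e.
Proof.
split=> [lin_e|[eD eZ] a u v]; last by rewrite eD; congr (_ + _); exact: eZ.
have eP k u v : e (kappa k *: u + v) = psi k *: e u + e v := lin_e k u v.
have eD : {morph e : u v / u + v}.
  by move=> u v; have := eP 1 u v; rewrite !rmorph1 !scale1r.
have e0 : e 0 = 0 by apply: (addrI (e 0)); rewrite -eD !addr0.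
by split=> // k u; rewrite -[_ *: u]addr0 eP e0 addr0.
Qed.

(** * Existence of the extension *)

Section DiffOp.
Variables (K R S : comPzRingType).
Variables (kappa : {rmorphism K -> R}) (phi : {rmorphism R -> S}).
Variables (U V : lmodType R) (D : U -> V).
Hypothesis phi_epi : flat_epi phi.
Hypothesis D_diff : diff_op kappa D.
Local Notation W := (extend phi V).
Local Notation E := (U -> W).
Local Notation rho := (@prescale R S U W).

Let rhoD := @prescaleD R S U W.
Let rhoZ := @prescaleZ R S U W.
Let rhoM := @prescaleM R S U W.

Let m : E := ext_unit phi (U:=V) \o D.

Lemma unit_lin_along : lin_along kappa (phi \o kappa) m.
Proof.
have [/lin_alongP[DD DZ] _] := D_diff.
by split=> [u v|k u]; rewrite /m /= ?DD ?DZ ?ext_unitD ?ext_unitZ.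
Qed.

Lemma unit_nil r : exists n, iter n (bitheta phi rho r) m = 0.
Proof.
have [_ /(_ r)[n Dn]] := D_diff; exists n.+1; rewrite iter_bitheta_unit.
apply: funext => u.
rewrite -[LHS]/(ext_unit phi (iter n.+1 (theta r) D u)) Dn.
by apply: (addrI (ext_unit phi (0 : V))); rewrite -ext_unitD !addr0.
Qed.

(** Here [sigma s] stands for [rho(s) D_R]. It is chosen for each [s] separately; the relations
    between different [s] must be recovered from the second clause. *)
Lemma unit_rmul : exists sigma : S -> E,
  [/\ forall s, exists2 f, bop rho f & sigma s = f m
    & forall s r a, phi r * s = phi a -> rho r (sigma s) = rho a m].
Proof.
have /choice[f fP] s : exists f, bop rho f /\
    forall r a, phi r * s = phi a -> rho r (f m) = rho a m.
  have [f bf fE] := locnil_rmul rhoD rhoZ rhoM phi_epi s unit_nil.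
  by exists f.
exists (fun s => f s m); split=> [s|s]; last exact: (fP s).2.
by exists (f s); first exact: (fP s).1.
Qed.

(** The denominators of [s] generate the unit ideal of [S], so [locnil_cancel] applies. *)
Lemma dense_cancel s (x : E) : locnil phi rho x ->
  (forall r a, phi r * s = phi a -> rho r x = 0) -> x = 0.
Proof.
move=> nx rx; have [l ls l1] := flat_epi_denominators phi_epi s.
apply: (locnil_cancel rhoD rhoZ rhoM (c := fst) (d := fst \o snd) l1 nx).
by rewrite big_seq big1 // => p /ls/rx /= ->; rewrite scaler0.
Qed.

Lemma diff_op_extend : exists D_S : extend phi U -> W,
  diff_op (phi \o kappa) D_S /\
  forall u, D_S (ext_unit phi u) = ext_unit phi (D u).
Proof.
have [sigma [sigmaB sigmaE]] := unit_rmul.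
have nsig s : locnil phi rho (sigma s).
  have [f bf ->] := sigmaB s; exact: (locnil_image rhoD rhoZ rhoM bf unit_nil).
have Lsig s : lin_along kappa (phi \o kappa) (sigma s).
  have [f bf ->] := sigmaB s; exact: (bop_lin_along bf unit_lin_along).
have nsub x y : locnil phi rho x -> locnil phi rho y -> locnil phi rho (x - y).
  move=> nx ny; rewrite -scaleN1r; apply: (locnil_add rhoD nx).
  exact: (locnil_image rhoD rhoZ rhoM (bop_scale rho (-1)) ny).
(* Additivity is tested after a denominator [r] of [s] and then [r'] of [s']: if [s = a / r] and
   [s' = a' / r'], then [r' r] is a denominator of [s + s'] with numerator [r' a + r a']. *)
have sD s s' u : sigma (s + s') u = sigma s u + sigma s' u.
  have nd := nsub _ _ (nsub _ _ (nsig (s + s')) (nsig s)) (nsig s').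
  suff: sigma (s + s') - sigma s - sigma s' = 0.
    move/(congr1 (@^~ u)) => /= /eqP; rewrite !fctE /=.
    by rewrite -addrA -opprD subr_eq0 => /eqP.
  apply: (dense_cancel (s := s) nd).
  move=> r a ra; apply: (dense_cancel (s := s')).
    exact: (locnil_image rhoD rhoZ rhoM (bop_rho rho r) nd).
  move=> r' a' ra'; rewrite -rhoM.
  have -> : rho (r' * r) (sigma (s + s') - sigma s - sigma s') =
     rho (r' * r) (sigma (s + s')) - rho (r' * r) (sigma s) -
     rho (r' * r) (sigma s').
    by [].
  rewrite (@sigmaE _ _ (r' * a + r * a')); last first.
    by rewrite rmorphD !rmorphM mulrDr -ra -ra' !mulrA [phi r * phi r']mulrC.
  rewrite (@sigmaE s _ (r' * a)); last by rewrite !rmorphM -ra mulrA.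
  rewrite (@sigmaE s' _ (r * a')); last first.
    by rewrite !rmorphM -ra' mulrA [_ * phi r]mulrC.
  apply: funext => v; rewrite !fctE /= /prescale scalerDl unit_lin_along.1.
  by rewrite addrAC addrK subrr.
have sZ r s u : sigma (phi r * s) u = sigma s (r *: u).
  suff: sigma (phi r * s) - rho r (sigma s) = 0.
    by move/(congr1 (@^~ u)) => /= /eqP; rewrite !fctE subr_eq0 => /eqP.
  apply: (@dense_cancel s).
    apply: nsub => //; exact: (locnil_image rhoD rhoZ rhoM (bop_rho rho r)).
  move=> t a ta.
  have -> : rho t (sigma (phi r * s) - rho r (sigma s)) =
     rho t (sigma (phi r * s)) - rho t (rho r (sigma s)) by [].
  rewrite (@sigmaE _ _ (r * a)) ?rmorphM -?ta 1?mulrCA //.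
  by rewrite -[rho t (rho r _)]rhoM [t * r]mulrC !rhoM (@sigmaE _ _ a) // subrr.
have bDl (s s' : restrict phi S^o) (u : U) :
  sigma ((s : S) + s') u = sigma s u + sigma s' u by exact: sD.
have bDr (s : restrict phi S^o) (u u' : U) :
  sigma s (u + u') = sigma s u + sigma s u' by exact: (Lsig s).1.
have bZ r (s : restrict phi S^o) (u : U) :
  sigma (r *: s : restrict phi S^o) u = sigma s (r *: u) by exact: sZ.
pose DS : extend phi U -> W := tlift (fun s : restrict phi S^o => sigma s).
have DSE s u : DS (etprod phi s u) = sigma s u by exact: tlift_tprod.
have DSD : {morph DS : x y / x + y} by exact: tliftD.
have DSat s : at_scalar s DS = sigma s by apply: funext => u; exact: DSE.
exists DS; split; last first.
  move=> u; rewrite DSE.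
  (* The fraction [1 = 1 / 1] gives [sigma 1 = m]. *)
  have /(congr1 (@^~ u)) := @sigmaE 1 1 1 (mulr1 _).
  by rewrite /prescale scale1r.
split.
  apply/lin_alongP; split=> // k.
  apply: tensor_ext => [x y|x y|s u].
  - by rewrite scalerDr DSD.
  - by rewrite DSD scalerDr.
  by rewrite [_ *: _]extend_scaleE !DSE sZ (Lsig s).2.
move=> t.
suff [n nE] :
    nil_at (bitheta (idfun : {rmorphism S -> S}) (@prescale S S _ W) t) DS.
  (* The definition asks for exponent [n.+1], so [theta] is applied once more, to zero. *)
  exists n => x; rewrite -iter_bitheta_theta iterS nE.
  by rewrite /bitheta /prescale !fctE scaler0 subrr.
(* Only [t = phi r] remains. Each slice of [DS] is some [f m] with [f] commuting with [theta_r], so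
   the exponent [n] of [m] serves all slices at once. *)
apply: (locnil_flat_epi _ _ (@prescaleM _ _ _ W) phi_epi) => // r.
have [n nm] := unit_nil r; exists n.
apply: extend_ext.
- elim: n {nm} => //= n IHn x y; rewrite /bitheta /prescale !fctE.
  by rewrite scalerDr !IHn scalerDr opprD addrACA.
- by move=> x y; exact/esym/addr0.
move=> s; rewrite iter_bitheta_at_scalar DSat; have [f bf ->] := sigmaB s.
by rewrite (bop_iterC rhoD rhoZ rhoM) ?nm ?(bop_at0 rhoD) //; exact: bop_theta.
Qed.

End DiffOp.

(** The slices of [D1] and [D2] at [s] are locally nilpotent. Their difference is killed by every
    denominator [r] of [s], since [s (x) r u = 1 (x) a u] and the two maps agree there. *)
Lemma diff_op_extend_uniq (K R S : comPzRingType) (kappa : {rmorphism K -> S})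
    (phi : {rmorphism R -> S}) (U V : lmodType R)
    (D1 D2 : extend phi U -> extend phi V) :
  flat_epi phi -> diff_op kappa D1 -> diff_op kappa D2 ->
  (forall u, D1 (ext_unit phi u) = D2 (ext_unit phi u)) -> D1 = D2.
Proof.
move=> phi_epi [/lin_alongP[D1D _] D1n] [/lin_alongP[D2D _] D2n] D12.
apply: extend_ext => // s; apply/eqP; rewrite -subr_eq0; apply/eqP.
pose rho := @prescale R S U (extend phi V).
have nilD (D : extend phi U -> extend phi V) :
    (forall r, exists n, iter n.+1 (theta r) D =1 (fun=> 0)) ->
    locnil phi rho (at_scalar s D).
  move=> Dn r; have [n nE] := Dn (phi r); exists n.+1.
  rewrite /rho -iter_bitheta_at_scalar; apply: funext => u.
  by rewrite /at_scalar iter_bitheta_theta nE.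
apply: (dense_cancel phi_epi (s := s)).
  rewrite -scaleN1r; apply: locnil_add; [by []|exact: nilD|].
  apply: locnil_image; [by []|by []|exact: prescaleM| |exact: nilD].
  exact: bop_scale.
move=> r a ra; apply: funext => u; rewrite /prescale !fctE /at_scalar.
rewrite etprodZ ra.
have -> : etprod phi (phi a) u = ext_unit phi (a *: u).
  by rewrite /ext_unit etprodZ mulr1.
by rewrite D12 subrr.
Qed.

Theorem theorem6p2 (K R S : comPzRingType)
  (kappa : {rmorphism K -> R}) (phi : {rmorphism R -> S})
  (U V : lmodType R) (D_R : U -> V) :
  flat_epi phi ->
  diff_op kappa D_R ->
  exists! D_S : extend phi U -> extend phi V,
    diff_op (phi \o kappa) D_S /\
    forall u : U, D_S (ext_unit phi u) = ext_unit phi (D_R u).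
Proof.
move=> phi_epi D_diff; have [D [DD DE]] := diff_op_extend phi_epi D_diff.
exists D; split=> // D' [D'D D'E].
by apply: (diff_op_extend_uniq phi_epi DD D'D) => u; rewrite DE D'E.
Qed.
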